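(* Let $K$ be a compact convex set in a locally convex space, let $F\subset K$ be a closed split face, and let $J=\{a\in A(K): a|_F=0\}$, with quotient map $\pi:A(K)\to A(K)/J$. Suppose that for every order unit space $E$ and every non-negative bounded linear operator $T:E\to A(K)/J$ there is a non-negative bounded linear operator $T':E\to A(K)$ with $\pi\circ T'=T$ and $\|T'\|=\|T\|$. Then there exists an affine continuous map $\phi:K\to F$ with $\phi(k)=k$ for all $k\in F$. Consequently $(A(K),J)$ has the quotient lifting property.
   Context: $A(K)$ denotes the order unit space of real-valued affine continuous functions on $K$, with the supremum norm, pointwise order and order unit $1$. A face $F$ of $K$ is a split face if its complementary face $F'$ (the union of all faces of $K$ disjoint from $F$) is convex and every $k\in K\setminus(F\cup F')$ has a unique representation $k=\lambda y+(1-\lambda)z$ with $y\in F$, $z\in F'$, $0<\lambda<1$. For a closed split face, $A(K)/J$ is identified isometrically and order-isomorphically with $A(F)$ via $\pi(a)\mapsto a|_F$; this gives the order on $A(K)/J$. For a Banach space $X$ and closed subspace $J$, $(X,J)$ has the quotient lifting property (QLP) if for every Banach space $Y$ and every bounded linear $S:Y\to X/J$ there is a bounded linear $T:Y\to X$ with $\pi\circ T=S$ and $\|T\|=\|S\|$. *)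

(* Defs.v *)
From HB Require Import structures.
From mathcomp Require Import all_boot all_order all_algebra.
From mathcomp Require Import all_classical all_reals all_analysis.
Set Implicit Arguments. Unset Strict Implicit. Unset Printing Implicit Defensive.
Import Order.TTheory GRing.Theory Num.Theory.
Import numFieldNormedType.Exports.
Local Open Scope classical_set_scope.
Local Open Scope ring_scope.

Section Defs.
Variable R : realType.

Section Convex.
Variable V : tvsType R.

Definition convexS (A : set V) : Prop :=
  forall x y (t : R), A x -> A y -> 0 <= t -> t <= 1 ->
    A (t *: x + (1 - t) *: y).

Definition affine_on (K : set V) (f : V -> R) : Prop :=
  forall x y (t : R), K x -> K y -> 0 <= t -> t <= 1 ->
    f (t *: x + (1 - t) *: y) = t * f x + (1 - t) * f y.

Definition affine_map_on (K : set V) (g : V -> V) : Prop :=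
  forall x y (t : R), K x -> K y -> 0 <= t -> t <= 1 ->
    g (t *: x + (1 - t) *: y) = t *: g x + (1 - t) *: g y.

Definition AK (K : set V) (f : V -> R) : Prop :=
  affine_on K f /\ {within K, continuous f}.

Definition face (K F : set V) : Prop :=
  F `<=` K /\ convexS F /\
  forall y z (t : R), K y -> K z -> 0 < t -> t < 1 ->
    F (t *: y + (1 - t) *: z) -> F y /\ F z.

Definition compl_face (K F : set V) : set V :=
  [set k | exists G : set V, [/\ face K G, G `&` F = set0 & G k]].

Definition split_face (K F : set V) : Prop :=
  [/\ face K F, convexS (compl_face K F) &
      forall k, K k -> ~ F k -> ~ compl_face K F k ->
        exists! p : R * V * V,
          [/\ F p.1.2, compl_face K F p.2, 0 < p.1.1, p.1.1 < 1 &
              k = p.1.1 *: p.1.2 + (1 - p.1.1) *: p.2]].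

Definition supnorm (K : set V) (f : V -> R) : R := sup [set `|f k| | k in K].

(** Elements of A(K)/J, J = {a in A(K) : a|_F = 0}: a class pi(a) is
    determined by a|_F; we represent it by any g : V -> R agreeing on F
    with some a in A(K). *)
Definition quot_elem (K F : set V) (g : V -> R) : Prop :=
  exists a, AK K a /\ forall k, F k -> a k = g k.

Definition qnorm (K F : set V) (g : V -> R) : R :=
  inf [set supnorm K a | a in [set a | AK K a /\ forall k, F k -> a k = g k]].

Definition lin_on (E : lmodType R) (D : set V) (T : E -> V -> R) : Prop :=
  forall (c : R) x y k, D k -> T (c *: x + y) k = c * T x k + T y k.

End Convex.

Definition bounded_op (E G : Type) (nE : E -> R) (nG : G -> R) (T : E -> G)
  : Prop := exists M : R, forall x, nG (T x) <= M * nE x.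

Definition opnorm (E G : Type) (nE : E -> R) (nG : G -> R) (T : E -> G) : R :=
  sup [set nG (T x) | x in [set x | nE x <= 1]].

Record is_OUS (E : lmodType R) (le : E -> E -> Prop) (u : E) : Prop := {
  ous_refl : forall x, le x x;
  ous_antisym : forall x y, le x y -> le y x -> x = y;
  ous_trans : forall x y z, le x y -> le y z -> le x z;
  ous_add : forall x y z, le x y -> le (x + z) (y + z);
  ous_scale : forall (c : R) x y, 0 <= c -> le x y -> le (c *: x) (c *: y);
  ous_unit : forall x, exists l : R, le (- (l *: u)) x /\ le x (l *: u);
  ous_archimedean : forall x,
    (forall eps : R, 0 < eps -> le x (eps *: u)) -> le x 0 }.

Definition ounorm (E : lmodType R) (le : E -> E -> Prop) (u : E) (x : E) : R :=
  inf [set l : R | 0 < l /\ le (- (l *: u)) x /\ le x (l *: u)].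

End Defs.

(* Main.v *)
(** A lift of the identity of A(K)/J = A(F) sends each k in K to a positive
    functional on A(F); after normalisation it is a state of A(F), that is,
    evaluation at a unique point phi k of F, and phi is the retraction.
    Composing with phi is then an isometric lifting of A(K)/J into A(K), whence
    the quotient lifting property.

    The identity of A(F), with the sup norm over F, has norm at most 1 into
    A(K)/J because functions on F extend to K with almost the same sup norm.
    For |a| <= 1 on F, let A be the convex hull in V * R of the graph of a
    over F and of K * {-1}, and B that of the graph of a + e over F and of
    K * {1 + e}.  The split face decomposition makes A and B disjoint, and a
    hyperplane separating them is the graph of an element of A(K) bounded by
    1 + e and within e of a on F; the error is removed by iteration. *)
Require Import Defs.
From HB Require Import structures.
From mathcomp Require Import all_boot all_order all_algebra.
From mathcomp Require Import all_classical all_reals all_analysis.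
From mathcomp Require Import ring lra.
Set Implicit Arguments. Unset Strict Implicit. Unset Printing Implicit Defensive.
Import Order.TTheory GRing.Theory Num.Theory.
Import numFieldNormedType.Exports.
Local Open Scope classical_set_scope.
Local Open Scope ring_scope.

(** * Hahn-Banach for sublinear functionals *)

Definition sublinear (R : realType) (W : lmodType R) (p : W -> R) : Prop :=
  (forall x y, p (x + y) <= p x + p y) /\
  (forall t x, 0 <= t -> p (t *: x) = t * p x).

(** The inequality at [t^-1] and [t *: x] gives the reverse one, so an infimum of functionals needs
    checking in one direction only. *)
Lemma sublinear_homo (R : realType) (W : lmodType R) (p : W -> R) :
  p 0 = 0 -> (forall t x, 0 < t -> p (t *: x) <= t * p x) ->
  forall t x, 0 <= t -> p (t *: x) = t * p x.
Proof.
move=> p0 pZ t x; rewrite le_eqVlt => /predU1P[<-|t0].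
  by rewrite scale0r mul0r.
apply/le_anti/andP; split; first exact: pZ.
have := pZ t^-1 (t *: x).
rewrite invr_gt0 scalerA mulVf ?gt_eqF// scale1r => /(_ t0).
by rewrite ler_pdivlMl.
Qed.

Section Sublinear.
Variables (R : realType) (W : lmodType R).
Implicit Types p q : W -> R.

Lemma sublinear0 p : sublinear p -> p 0 = 0.
Proof. by case=> _ /(_ 0 0 (lexx _)); rewrite scale0r mul0r. Qed.

Lemma sublinearN p x : sublinear p -> - p (- x) <= p x.
Proof.
move=> ps; have := ps.1 x (- x); rewrite subrr (sublinear0 ps); lra.
Qed.

Lemma inf_le_lower (A : set R) (a m : R) : lbound A m -> A a -> inf A <= a.
Proof. by move=> Am Aa; apply: ge_inf => //; exists m. Qed.

Lemma inf_ge (A : set R) (a m : R) : A a -> lbound A m -> m <= inf A.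
Proof. by move=> Aa Am; apply: lb_le_inf => //; exists a. Qed.

(* The decrease of [p] in the direction [y]: if [p] is minimal it cannot
   decrease, and this forces additivity. *)
Lemma sublinear_decrease p (y : W) : sublinear p ->
  exists q, [/\ sublinear q, forall x, q x <= p x & q (- y) <= - p y].
Proof.
move=> ps; pose S x := [set p (x + t *: y) - t * p y | t in [set t : R | 0 <= t]].
have Slb x : lbound (S x) (- p (- x)).
  move=> _ [t /= t0 <-].
  have := ps.1 (x + t *: y) (- x); rewrite addrAC subrr add0r ps.2//; lra.
have Sin x t : 0 <= t -> S x (p (x + t *: y) - t * p y) by move=> t0; exists t.
pose q x := inf (S x).
have qle x t : 0 <= t -> q x <= p (x + t *: y) - t * p y.
  by move=> t0; apply: inf_le_lower (Slb x) _; exact: Sin.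
have qge x m : (forall t, 0 <= t -> m <= p (x + t *: y) - t * p y) -> m <= q x.
  move=> H; apply: (inf_ge (Sin x 0 (lexx _))) => _ [t /= t0 <-]; exact: H.
have q_le_p x : q x <= p x by have := qle x 0 (lexx _); rewrite scale0r addr0 mul0r subr0.
exists q; split => //; last first.
  by have := qle (- y) 1 ler01; rewrite scale1r addNr (sublinear0 ps) mul1r sub0r.
split.
  move=> a b; rewrite -lerBlDr; apply: (qge _ _) => t t0; rewrite lerBlDr -lerBlDl.
  apply: qge => s s0; rewrite lerBlDl.
  apply: (le_trans (qle _ (s + t) (addr_ge0 s0 t0))).
  have := ps.1 (b + s *: y) (a + t *: y).
  rewrite [b + _ + _]addrACA -scalerDl [b + a]addrC; lra.
apply: sublinear_homo => [|t x t0].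
  apply/le_anti/andP; split; first by rewrite -[leRHS](sublinear0 ps).
  by apply: qge => t t0; rewrite add0r ps.2// subrr.
rewrite mulrC -ler_pdivrMr//; apply: qge => s s0; rewrite ler_pdivrMr//.
apply: (le_trans (qle _ (t * s) (mulr_ge0 (ltW t0) s0))).
by rewrite -scalerA -scalerDr ps.2 ?(ltW t0)//; lra.
Qed.

(** The pointwise infimum works: comparison with [p0] bounds it below by [- p0 (- x)], and
    subadditivity holds since of two members of a chain the smaller one serves for both
    arguments. *)
Lemma sublinear_chain_inf (A : set (W -> R)) p0 : A p0 ->
  (forall p, A p -> sublinear p) ->
  (forall p q, A p -> A q -> (forall x, p x <= q x) \/ (forall x, q x <= p x)) ->
  exists q, sublinear q /\ (forall p, A p -> forall x, q x <= p x).
Proof.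
move=> Ap0 As Atot.
pose S x := [set p x | p in A].
have Slb x : lbound (S x) (- p0 (- x)).
  move=> _ [p /= Ap <-]; case: (Atot _ _ Ap Ap0) => H.
    apply: le_trans (sublinearN x (As _ Ap)); rewrite lerN2; exact: H.
  by apply: le_trans (H x); exact: sublinearN (As _ Ap0).
pose q x := inf (S x).
have qle p x : A p -> q x <= p x.
  by move=> Ap; apply: inf_le_lower (Slb x) _; exists p.
have qge x m : (forall p, A p -> m <= p x) -> m <= q x.
  move=> H; apply: (@inf_ge _ (p0 x)); first by exists p0.
  by move=> _ [p Ap <-]; exact: H.
exists q; split=> [|p Ap x]; last exact: qle.
split=> [x y|].
  rewrite -lerBlDr; apply: (qge _ _) => p Ap; rewrite lerBlDr -lerBlDl.
  apply: qge => r Ar; rewrite lerBlDl.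
  case: (Atot _ _ Ap Ar) => H.
    have := (As _ Ap).1 x y; have := qle _ (x + y) Ap; have := H y; lra.
  have := (As _ Ar).1 x y; have := qle _ (x + y) Ar; have := H x; lra.
apply: sublinear_homo => [|t x t0].
  apply/le_anti/andP; split.
    by rewrite -[leRHS](sublinear0 (As _ Ap0)); exact: qle.
  by apply: qge => p Ap; rewrite (sublinear0 (As _ Ap)).
rewrite mulrC -ler_pdivrMr//; apply: qge => p Ap; rewrite ler_pdivrMr//.
by apply: le_trans (qle _ _ Ap) _; rewrite (As _ Ap).2 ?(ltW t0)// mulrC.
Qed.

(** Zorn's lemma yields a minimal sublinear functional below [p]. Minimality and
    [sublinear_decrease] force [l (- y) = - l y], which turns subadditivity into linearity. *)
Lemma hahn_banach_sublinear p : sublinear p ->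
  exists l : W -> R, [/\ forall x y, l (x + y) = l x + l y,
    forall t x, l (t *: x) = t * l x & forall x, l x <= p x].
Proof.
move=> ps.
pose T := {q : W -> R | sublinear q /\ forall x, q x <= p x}.
(* The order is reversed, so that a maximal element is a minimal functional. *)
pose le (f g : T) := `[< forall x, sval g x <= sval f x >].
have [||||[l [ls lp]] lmin] := @Zorn T le.
- by move=> f; apply/asboolP.
- move=> f g h /asboolP fg /asboolP gh; apply/asboolP => x.
  exact: le_trans (gh x) (fg x).
- move=> [f fP] [g gP] /asboolP fg /asboolP gf; apply: eq_exist; apply/funext => x.
  by apply/le_anti/andP; split; [exact: gf|exact: fg].
- move=> A Atot; have [[f0 Af0]|/forallNP A0] := pselect (exists f, A f); last first.
    by exists (exist _ p (conj ps (fun x => lexx (p x)))) => f /A0.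
  have [|q [f Af <-]|q r [f Af <-] [g Ag <-]|q [qs qle]] :=
      @sublinear_chain_inf [set sval f | f in A] (sval f0).
  + by exists f0.
  + exact: (svalP f).1.
  + by case: (Atot _ _ Af Ag) => /asboolP H; [right|left].
  + have qp x : q x <= p x.
      apply: le_trans ((svalP f0).2 x); apply: qle; by exists f0.
    exists (exist _ q (conj qs qp)) => f Af; apply/asboolP => x /=.
    by apply: qle; exists f.
have {}lmin q : sublinear q -> (forall x, q x <= l x) -> q = l.
  move=> qs ql; have qp x : q x <= p x := le_trans (ql x) (lp x).
  pose q' : T := exist _ q (conj qs qp).
  by rewrite -[q]/(sval q') (lmin q')//; exact/asboolP.
have lN y : l (- y) = - l y.
  have [q [qs ql qy]] := sublinear_decrease y ls.
  rewrite (lmin q qs ql) in qy; have := sublinearN y ls; lra.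
exists l; split => //.
  move=> x y; apply/le_anti; rewrite ls.1 /=.
  have := ls.1 (x + y) (- y); rewrite addrK lN; lra.
move=> t x; have [t0|t0] := leP 0 t; first exact: ls.2.
by rewrite -[t]opprK scaleNr lN ls.2 ?mulNr ?oppr_ge0 ?(ltW t0)//; lra.
Qed.

End Sublinear.

(** * Separation of a compact convex set from the origin *)

Section Separation.
Variables (R : realType) (V : tvsType R).
Implicit Types (A D U : set V) (x y : V).

Lemma convexS_comb A x y (a b : R) : convexS A -> 0 <= a -> 0 <= b ->
  A x -> A y ->
  exists z, [/\ A z, a *: x + b *: y = (a + b) *: z &
    forall f : V -> R, affine_on A f -> a * f x + b * f y = (a + b) * f z].
Proof.
move=> cA a0 b0 Ax Ay; have [ab0|ab0] := ltP 0 (a + b); last first.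
  have -> : a = 0 by lra.
  have -> : b = 0 by lra.
  by exists x; rewrite !scale0r !addr0 scale0r; split => // f _; rewrite !mul0r addr0.
have t0 : 0 <= a / (a + b) by rewrite divr_ge0// ltW.
have t1 : a / (a + b) <= 1 by rewrite ler_pdivrMr// mul1r lerDl.
have tE : 1 - a / (a + b) = b / (a + b) by field; rewrite gt_eqF.
exists ((a / (a + b)) *: x + (1 - a / (a + b)) *: y); split.
- exact: cA.
- rewrite tE scalerDr !scalerA.
  by congr (_ *: _ + _ *: _); field; rewrite gt_eqF.
- by move=> f /(_ _ _ _ Ax Ay t0 t1) ->; rewrite tE; field; rewrite gt_eqF.
Qed.

(** The infimum [p x] of [m (x + s *: d) - s] is finite because [1 <= m] on [D]; it is sublinear,
    lies below [m], and has [p (- d) <= -1]. A linear [l] below [p] then satisfies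
    [l d = - l (- d) >= 1]. *)
Lemma sublinear_separation D (m : V -> R) : convexS D -> D !=set0 ->
  sublinear m -> (forall d, D d -> 1 <= m d) ->
  exists l : V -> R, [/\ forall x y, l (x + y) = l x + l y,
    forall t x, l (t *: x) = t * l x, forall x, l x <= m x &
    forall d, D d -> 1 <= l d].
Proof.
move=> cD [d0 Dd0] ms m1.
pose S x := [set m (x + sd.1 *: sd.2) - sd.1 | sd in [set sd : R * V | 0 <= sd.1 /\ D sd.2]].
have Slb x : lbound (S x) (- m (- x)).
  move=> _ [[s d] /= [s0 Dd] <-].
  have := ms.1 (x + s *: d) (- x); rewrite addrAC subrr add0r ms.2//.
  have := ler_wpM2l s0 (m1 _ Dd); lra.
pose p x := inf (S x).
have ple x s d : 0 <= s -> D d -> p x <= m (x + s *: d) - s.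
  by move=> s0 Dd; apply: inf_le_lower (Slb x) _; exists (s, d).
have pge x c : (forall s d, 0 <= s -> D d -> c <= m (x + s *: d) - s) -> c <= p x.
  move=> H; apply: (@inf_ge _ _ (m (x + 0 *: d0) - 0)); first by exists (0, d0).
  by move=> _ [[s d] /= [s0 Dd] <-]; exact: H.
have pm x : p x <= m x.
  by have := ple x 0 d0 (lexx _) Dd0; rewrite scale0r addr0 subr0.
have ps : sublinear p.
  split=> [x y|].
    rewrite -lerBlDr; apply: (pge x) => s d s0 Dd; rewrite lerBlDr -lerBlDl.
    apply: pge => t e t0 De; rewrite lerBlDl.
    have [z [Dz zE _]] := convexS_comb cD s0 t0 Dd De.
    have := ms.1 (x + s *: d) (y + t *: e); rewrite addrACA zE.
    have [st0|st0] := ltP 0 (s + t).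
      have := ple (x + y) (s + t) z (ltW st0) Dz; lra.
    have -> : s + t = 0 by lra.
    have := pm (x + y); rewrite scale0r addr0; lra.
  apply: sublinear_homo => [|t x t0].
    apply/le_anti/andP; split; first by rewrite -[leRHS](sublinear0 ms).
    apply: pge => t e t0 De; rewrite add0r ms.2//; have := ler_wpM2l t0 (m1 _ De); lra.
  rewrite mulrC -ler_pdivrMr//; apply: pge => s d s0 Dd; rewrite ler_pdivrMr//.
  apply: (le_trans (ple _ (t * s) d (mulr_ge0 (ltW t0) s0) Dd)).
  by rewrite -scalerA -scalerDr ms.2 ?(ltW t0)//; lra.
have [l [lD lZ lp]] := hahn_banach_sublinear ps.
exists l; split => // [x|d Dd]; first exact: le_trans (lp x) (pm x).
have := ple (- d) 1 d ler01 Dd; rewrite scale1r addNr (sublinear0 ms).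
have := lp (- d); rewrite -scaleN1r lZ; lra.
Qed.

Definition gauge_of U x : R := inf [set t : R | 0 < t /\ U (t^-1 *: x)].

Section Gauge.
Variable U : set V.
Hypotheses (cU : convexS U) (U0 : U 0).
Hypothesis absU : forall x, exists2 t : R, 0 < t & U (t^-1 *: x).

Let lb0 x : lbound [set t : R | 0 < t /\ U (t^-1 *: x)] 0.
Proof. by move=> t [/ltW]. Qed.

Let gle x t : 0 < t -> U (t^-1 *: x) -> gauge_of U x <= t.
Proof. by move=> t0 Ut; rewrite /gauge_of; apply: (inf_le_lower (@lb0 x)). Qed.

Let gge x c : (forall t, 0 < t -> U (t^-1 *: x) -> c <= t) -> c <= gauge_of U x.
Proof.
move=> H; have [t t0 Ut] := absU x.
by apply: (@inf_ge _ _ t) => // s [s0 Us]; exact: H.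
Qed.

Lemma gauge_of_le1 x : U x -> gauge_of U x <= 1.
Proof. by move=> Ux; apply: gle => //; rewrite invr1 scale1r. Qed.

Lemma gauge_of_ge1 x : ~ U x -> 1 <= gauge_of U x.
Proof.
move=> nUx; apply: gge => t t0 Ut; rewrite leNgt; apply/negP => t1; apply: nUx.
have := cU Ut U0 (ltW t0) (ltW t1).
by rewrite scaler0 addr0 scalerA divff ?gt_eqF// scale1r.
Qed.

Lemma gauge_of_sublinear : sublinear (gauge_of U).
Proof.
split=> [x y|].
  rewrite -lerBlDr; apply: gge => t t0 Ut; rewrite lerBlDr -lerBlDl.
  apply: gge => s s0 Us; rewrite lerBlDl.
  have [z [Uz zE _]] := convexS_comb cU (ltW t0) (ltW s0) Ut Us.
  move: zE; rewrite !scalerA !divff ?gt_eqF// !scale1r => ->.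
  have ts0 : 0 < t + s by rewrite addr_gt0.
  apply: gle; rewrite // scalerA mulVf ?gt_eqF// scale1r; exact: Uz.
apply: sublinear_homo => [|t x t0].
  apply/le_anti/andP; split; last by apply: gge => t /ltW.
  apply/ler_addgt0Pl => e e0; rewrite addr0; apply: gle => //.
  by rewrite scaler0.
rewrite mulrC -ler_pdivrMr//; apply: gge => s s0 Us; rewrite ler_pdivrMr//.
apply: gle; first by rewrite mulr_gt0.
by rewrite scalerA invfM -mulrA mulVf ?gt_eqF// mulr1.
Qed.
End Gauge.

Lemma nbhs0_absorbing U : nbhs (0 : V) U ->
  forall x, exists2 t : R, 0 < t & U (t^-1 *: x).
Proof.
move=> U0 x.
have /(_ U) := @scale_continuous R V (0, x); rewrite /= scale0r => /(_ U0).
case=> -[A B] /= [A0 Bx] ABU.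
have [e /= e0 eA] := A0.
have e2 : 0 < e / 2 by rewrite divr_gt0.
exists (e / 2)^-1; first by rewrite invr_gt0.
rewrite invrK; apply: (ABU (_, _)); split => /=; last exact: nbhs_singleton.
by apply: eA; rewrite /= sub0r normrN gtr0_norm// ltr_pdivrMr// ltr_pMr// ltr1n.
Qed.

(** The bound on [U] is one-sided; a two-sided one holds on the intersection of [x + (e / 2) U] and
    [x - (e / 2) U]. *)
Lemma linear_continuous_nbhs (l : V -> R) U : nbhs (0 : V) U ->
  (forall x y, l (x + y) = l x + l y) -> (forall t x, l (t *: x) = t * l x) ->
  (forall x, U x -> l x <= 1) -> continuous l.
Proof.
move=> U0 lD lZ lU x; apply/cvgrPdist_lt => e e0.
have e2 : e / 2 != 0 by rewrite gt_eqF// divr_gt0.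
have e2' : - (e / 2) != 0 by rewrite oppr_eq0.
apply: filterS (filterI (nbhsT x (nbhs0Z e2 U0)) (nbhsT x (nbhs0Z e2' U0))).
move=> y [[_ [u Uu <-] <-] [_ [v Uv <-] /addrI/esym vu]].
have := lU _ Uu; have := lU _ Uv => v1 u1.
have uv : (e / 2) * l u = - (e / 2) * l v by rewrite -!lZ vu.
rewrite lD lZ opprD addNKr normrN ltr_norml; apply/andP; split; nra.
Qed.

(** The closed set [D] misses a convex neighbourhood of 0. The gauge of that neighbourhood is at
    least 1 on [D], and a linear functional below it is continuous. *)
Lemma compact_convex_separation D : hausdorff_space V ->
  compact D -> convexS D -> D !=set0 -> ~ D 0 ->
  exists l : V -> R, [/\ forall x y, l (x + y) = l x + l y,
    forall t x, l (t *: x) = t * l x, continuous l &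
    forall d, D d -> 1 <= l d].
Proof.
move=> hV kD cD D0 nD0.
have [B cB [Bo /(_ 0) Bb]] := @locally_convex R V.
have : nbhs 0 (~` D).
  apply: open_nbhs_nbhs; split => //.
  by apply: closed_openC; exact: compact_closed.
move=> /Bb [U [BU U0] UD].
have nU : nbhs 0 U by apply: open_nbhs_nbhs; split => //; exact: Bo.
have cU : convexS U.
  move=> x y t Ux Uy t0 t1.
  exact: set_mem (cB U (mem_set BU) x y (Itv01 t0 t1) (mem_set Ux) (mem_set Uy)).
have abs := nbhs0_absorbing nU.
have gs := gauge_of_sublinear cU U0 abs.
have [|l [lD lZ lm l1]] := sublinear_separation cD D0 gs.
  by move=> d Dd; apply: gauge_of_ge1 => // /UD.
exists l; split => //; apply: (linear_continuous_nbhs nU) => // x Ux.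
exact: le_trans (lm x) (gauge_of_le1 Ux).
Qed.

End Separation.

(** * Convex hulls of unions and split faces *)

Lemma hausdorff_prod (X Y : topologicalType) :
  hausdorff_space X -> hausdorff_space Y -> hausdorff_space (X * Y)%type.
Proof.
move=> hX hY [x y] [x' y'] cl; congr pair.
  apply: hX => A B xA xB.
  have [] := cl (fst @^-1` A) (fst @^-1` B) (cvg_fst xA) (cvg_fst xB).
  by move=> [u v] [Au Bu]; exists u.
apply: hY => A B xA xB.
have [] := cl (snd @^-1` A) (snd @^-1` B) (cvg_snd xA) (cvg_snd xB).
by move=> [u v] [Au Bu]; exists v.
Qed.

Section Join.
Variables (R : realType) (W : tvsType R).
Implicit Types A B : set W.

(** For nonempty convex [A] and [B], the convex hull of their union. The two-point form exhibits it
    as a continuous image of [[0, 1] * A * B], hence compact when [A] and [B] are. *)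
Definition joinS A B : set W :=
  [set w | exists t a b, [/\ 0 <= t, t <= 1, A a, B b & w = t *: a + (1 - t) *: b]].

Lemma compact_joinS A B : compact A -> compact B -> compact (joinS A B).
Proof.
move=> kA kB.
pose f (x : R^o * (W * W)) := x.1 *: x.2.1 + (1 - x.1) *: x.2.2.
have cf : continuous f.
  move=> x.
  apply: (@continuous_comp _ (W * W)%type _
    (fun x : R^o * (W * W) => (x.1 *: x.2.1, (1 - x.1) *: x.2.2))
    (fun z => z.1 + z.2)); last exact: add_continuous.
  apply: cvg_pair => /=.
    apply: (@continuous_comp _ (R^o * W)%type _
      (fun x : R^o * (W * W) => (x.1, x.2.1)) (fun z => z.1 *: z.2)).
      apply: (@cvg_pair _ _ _ _ (nbhs (x.1 : R^o)) (nbhs x.2.1)) => /=.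
        exact: cvg_fst.
      by apply: continuous_comp; [exact: cvg_snd|exact: cvg_fst].
    exact: scale_continuous.
  apply: (@continuous_comp _ (R^o * W)%type _
    (fun x : R^o * (W * W) => (1 - x.1, x.2.2)) (fun z => z.1 *: z.2)).
    apply: (@cvg_pair _ _ _ _ (nbhs (1 - x.1 : R^o)) (nbhs x.2.2)) => /=.
      by apply: cvgB; [exact: cvg_cst|exact: cvg_fst].
    by apply: continuous_comp; [exact: cvg_snd|exact: cvg_snd].
  exact: scale_continuous.
have -> : joinS A B = f @` (`[0, 1]%classic `*` (A `*` B)).
  apply/seteqP; split => [_ [t [a [b [t0 t1 Aa Bb ->]]]]|_ [[t [a b]] /= [+ [Aa Bb]] <-]].
    by exists (t, (a, b)) => //=; rewrite in_itv /= t0 t1.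
  by rewrite in_itv /= => /andP[t0 t1]; exists t, a, b.
apply: continuous_compact; first exact: continuous_subspaceT.
by apply: compact_setX; [exact: segment_compact|exact: compact_setX].
Qed.

Lemma convexS_joinS A B : convexS A -> convexS B -> convexS (joinS A B).
Proof.
move=> cA cB _ _ s [t [a [b [t0 t1 Aa Bb ->]]]] [t' [a' [b' [t'0 t'1 Aa' Bb' ->]]]] s0 s1.
have s1' : 0 <= 1 - s by rewrite subr_ge0.
have [a2 [Aa2 a2E _]] := convexS_comb cA (mulr_ge0 s0 t0) (mulr_ge0 s1' t'0) Aa Aa'.
have u0 : 0 <= 1 - t by rewrite subr_ge0.
have u0' : 0 <= 1 - t' by rewrite subr_ge0.
have [b2 [Bb2 b2E _]] := convexS_comb cB (mulr_ge0 s0 u0) (mulr_ge0 s1' u0') Bb Bb'.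
exists (s * t + (1 - s) * t'), a2, b2; split => //; [nra|nra|].
rewrite !scalerDr !scalerA addrACA a2E b2E; congr (_ + _ *: _); ring.
Qed.

(** Disjointness of [A] and [B] means that 0 is not in [diffS A B], so separating two sets reduces
    to separating one from the origin. *)
Definition diffS A B : set W := [set ab.1 - ab.2 | ab in A `*` B].

Lemma compact_diffS A B : compact A -> compact B -> compact (diffS A B).
Proof.
move=> kA kB; apply: continuous_compact; last exact: compact_setX.
by apply: continuous_subspaceT; exact: sub_continuous.
Qed.

Lemma convexS_diffS A B : convexS A -> convexS B -> convexS (diffS A B).
Proof.
move=> cA cB _ _ s [[a b] /= [Aa Bb] <-] [[a' b'] /= [Aa' Bb'] <-] s0 s1.
exists (s *: a + (1 - s) *: a', s *: b + (1 - s) *: b').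
  by split; [exact: cA|exact: cB].
by rewrite /= !scalerBr opprD addrACA.
Qed.

End Join.

Section SplitFace.
Variables (R : realType) (V : tvsType R) (K F : set V).
Hypotheses (cK : convexS K) (sF : split_face K F).

(** The split decomposition extended to the endpoints: weight 1 on [F] and weight 0 on the
    complementary face. At [s = 1] the point [z] is unconstrained, as the complementary face may be
    empty. *)
Definition split_rep k (s : R) (y z : V) : Prop :=
  [/\ F y, 0 <= s, s <= 1, s < 1 -> compl_face K F z & k = s *: y + (1 - s) *: z].

Let FK : F `<=` K. Proof. by case: sF => -[]. Qed.
Let cF : convexS F. Proof. by case: sF => -[_ []]. Qed.

Lemma compl_face_sub : compl_face K F `<=` K.
Proof. by move=> k [G [[GK _] _ /GK]]. Qed.

Lemma compl_face_disj k : F k -> ~ compl_face K F k.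
Proof.
move=> Fk [G [_ GF Gk]].
by have : (G `&` F) k by []; rewrite GF.
Qed.

Lemma split_rep_exists k : F !=set0 -> K k -> exists s y z, split_rep k s y z.
Proof.
move=> [y0 Fy0] Kk.
have [Fk|nFk] := pselect (F k).
  by exists 1, k, k; split; rewrite ?ltxx ?subrr ?scale1r ?scale0r ?addr0.
have [F'k|nF'k] := pselect (compl_face K F k).
  by exists 0, y0, k; split => //; rewrite ?ltr01 ?scale0r ?add0r ?subr0 ?scale1r.
have [_ _ /(_ k Kk nFk nF'k)[[[s y] z] [[/= Fy F'z s0 s1 kE] _]]] := sF.
by exists s, y, z; split => //; [exact: ltW s0|exact: ltW s1].
Qed.

(** With [0 < s < 1], the face property excludes [k] from [F], as [z] would lie in [F], and from any
    face disjoint from [F], as [y] would lie in that face. *)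
Lemma split_rep_class k s y z : split_rep k s y z ->
  [\/ s = 1 /\ F k, s = 0 /\ compl_face K F k |
     [/\ 0 < s, s < 1, ~ F k & ~ compl_face K F k]].
Proof.
move=> [Fy + + F'z ->]; rewrite le_eqVlt => /predU1P[s0 _|s0].
  rewrite -s0 in F'z *; apply: Or32; split => //.
  by rewrite scale0r add0r subr0 scale1r; exact: F'z ltr01.
rewrite le_eqVlt => /predU1P[->|s1].
  by apply: Or31; split => //; rewrite subrr scale0r addr0 scale1r.
have {}F'z := F'z s1.
have Kz := compl_face_sub F'z.
apply: Or33; split => //.
  case: sF => -[_ [_ fF]] _ _ /(fF _ _ _ (FK Fy) Kz s0 s1)[_ Fz].
  exact: compl_face_disj Fz F'z.
case=> G [[GK [_ fG]] GF /(fG _ _ _ (FK Fy) Kz s0 s1)[Gy _]].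
by have : (G `&` F) y by []; rewrite GF.
Qed.

Lemma split_rep_uniq k s y z s' y' z' : K k ->
  split_rep k s y z -> split_rep k s' y' z' -> s = s' /\ (0 < s -> y = y').
Proof.
move=> Kk r r'; case: (split_rep_class r) => [[s1 Fk]|[s0 F'k]|[s0 s1 nF nF']].
- case: (split_rep_class r') => [[s'1 _]|[_ /(compl_face_disj Fk)]|[_ _ /(_ Fk)]]//.
  case: r r' => _ _ _ _ -> [_ _ _ _]; rewrite s1 s'1.
  by rewrite !subrr !scale0r !addr0 !scale1r => ->.
- case: (split_rep_class r') => [[_ /compl_face_disj/(_ F'k)]|[-> _]|[_ _ _ /(_ F'k)]]//.
  by rewrite s0 ltxx.
- case: (split_rep_class r') => [[_ /nF]|[_ /nF']|[s'0 s'1 _ _]]//.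
  case: sF => _ _ /(_ k Kk nF nF')[p0 [_ p0u]].
  case: r r' => Fy _ _ Fz kE [Fy' _ _ Fz' kE'].
  have e1 : p0 = (s, y, z) by apply: p0u; split => //; exact: Fz.
  have : p0 = (s', y', z') by apply: p0u; split => //; exact: Fz'.
  by rewrite e1 => -[].
Qed.

(** Mixing [k] with a point of [F] keeps its complementary component [z] and changes only the weight
    and the component in [F]. *)
Lemma split_rep_join k l u z x s : F x -> 0 <= s -> s <= 1 ->
  split_rep k l u z -> exists2 v,
    split_rep (s *: x + (1 - s) *: k) (s + (1 - s) * l) v z &
    forall f, affine_on F f ->
      s * f x + (1 - s) * l * f u = (s + (1 - s) * l) * f v.
Proof.
move=> Fx s0 s1 [Fu l0 l1 F'z ->].
have s1' : 0 <= 1 - s by rewrite subr_ge0.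
have [v [Fv vE fv]] := convexS_comb cF s0 (mulr_ge0 s1' l0) Fx Fu.
exists v => //; split => //.
- nra.
- nra.
- by move=> h; apply: F'z; rewrite ltNge; apply/negP => l1'; nra.
- rewrite -vE scalerDr !scalerA addrA; congr (_ + _ *: _); ring.
Qed.

End SplitFace.

(** * Extension of affine functions from a closed split face *)

Section Extension.
Variables (R : realType) (V : tvsType R) (K F : set V).
Hypotheses (hV : hausdorff_space V) (kK : compact K) (cK : convexS K).
Hypotheses (clF : closed F) (sF : split_face K F) (F0 : F !=set0).
Implicit Types (a b c f g : V -> R).

Let FK : F `<=` K. Proof. by case: sF => -[]. Qed.
Let cF : convexS F. Proof. by case: sF => -[_ []]. Qed.
Let kF : compact F. Proof. exact: subclosed_compact kK FK. Qed.

Lemma affine_on_sub (A B : set V) f : A `<=` B -> affine_on B f -> affine_on A f.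
Proof. by move=> AB fB x y t /AB Bx /AB By; exact: fB. Qed.

Definition graphS (A : set V) f : set (V * R^o)%type := [set (x, f x : R^o) | x in A].

Lemma compact_graphS (A : set V) f :
  compact A -> {within A, continuous f} -> compact (graphS A f).
Proof.
move=> kA cf; apply: continuous_compact kA.
move=> x; apply: (@cvg_pair _ _ _ _ (nbhs (x : V)) (nbhs (f x : R^o))) => /=.
  by apply: (@continuous_subspaceT _ _ A id) => ?; exact: cvg_id.
exact: cf.
Qed.

Lemma convexS_graphS (A : set V) f :
  convexS A -> affine_on A f -> convexS (graphS A f).
Proof.
move=> cA fA _ _ t [x Ax <-] [y Ay <-] t0 t1.
by exists (t *: x + (1 - t) *: y); [exact: cA|rewrite fA].
Qed.

Lemma affine_on_cst (A : set V) (r : R) : affine_on A (fun=> r).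
Proof. by move=> x y t _ _ _ _; ring. Qed.

Lemma affine_onD (A : set V) f g : affine_on A f -> affine_on A g ->
  affine_on A (fun x => f x + g x).
Proof. by move=> fA gA x y t Ax Ay t0 t1; rewrite fA// gA//; ring. Qed.

(** At a common point, uniqueness of the decomposition equates the weights and, unless they vanish,
    the components in [F]; so [s * a x + (1 - s) * l * a u] equals [t * a y + (1 - t) * l' * a u'].
    As [|a| <= 1] on [F], the lower height is at most this common value and the upper height exceeds
    it by at least [e]. *)
Lemma split_face_disjoint a e : affine_on F a -> (forall x, F x -> `|a x| <= 1) ->
  0 < e ->
  ~ diffS (joinS (graphS F (fun x => a x + e)) (graphS K (fun=> 1 + e)))
          (joinS (graphS F a) (graphS K (fun=> -1))) 0.
Proof.
move=> aF a1 e0 [[_ _] /= [[t [_ [_ [t0 t1 [y Fy <-] [k' Kk' <-] ->]]]]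
                            [s [_ [_ [s0 s1 [x Fx <-] [k Kk <-] ->]]]]]] /eqP.
rewrite subr_eq0 => /eqP [/= E1 E2].
have [l [u [z r]]] := split_rep_exists sF F0 Kk.
have [l' [u' [z' r']]] := split_rep_exists sF F0 Kk'.
have [v rv fv] := split_rep_join sF Fx s0 s1 r.
have [w rw fw] := split_rep_join sF Fy t0 t1 r'.
rewrite E1 in rw.
have [sE vE] := split_rep_uniq sF (cK (FK Fx) Kk s0 s1) rv rw.
have h : (s + (1 - s) * l) * a v = (s + (1 - s) * l) * a w.
  have [/vE -> //|h] := ltP 0 (s + (1 - s) * l).
  case: r => _ l0 l1 _ _.
  have -> : s + (1 - s) * l = 0 by nra.
  by rewrite !mul0r.
have := fv _ aF; have := fw _ aF; rewrite h -sE => <- Eh.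
case: r r' => Fu l0 l1 _ _ [Fu' l'0 l'1 _ _].
have /ler_normlP [au _] := a1 _ Fu; have /ler_normlP [_ au'] := a1 _ Fu'.
have H1 := mulr_ge0 (mulr_ge0 (_ : 0 <= 1 - s) l0) (_ : 0 <= a u + 1).
have {}H1 : 0 <= (1 - s) * l * (a u + 1) by apply: H1; lra.
have H2 := mulr_ge0 (mulr_ge0 (_ : 0 <= 1 - t) l'0) (_ : 0 <= 1 - a u').
have {}H2 : 0 <= (1 - t) * l' * (1 - a u') by apply: H2; lra.
have H3 : 0 <= (1 - s) * (1 - l) by apply: mulr_ge0; lra.
have H4 : 0 <= (1 - t) * (1 - l') by apply: mulr_ge0; lra.
rewrite /GRing.scale/= in E2; lra.
Qed.

Lemma split_face_approx a e : AK K a -> (forall x, F x -> `|a x| <= 1) -> 0 < e ->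
  exists c, [/\ AK K c, forall k, K k -> `|c k| <= 1 + e &
    forall x, F x -> `|a x - c x| <= e].
Proof.
move=> [aK ca] a1 e0.
have aF := affine_on_sub FK aK.
have caF := continuous_subspaceW FK ca.
have aeF := affine_onD aF (@affine_on_cst F e).
have caeF : {within F, continuous (fun x => a x + e)}.
  by move=> x; apply: cvgD; [exact: caF|exact: cvg_cst].
have cst r : {within K, continuous (fun=> r : R)} by move=> x; exact: cvg_cst.
pose A := joinS (graphS F a) (graphS K (fun=> -1)).
pose B := joinS (graphS F (fun x => a x + e)) (graphS K (fun=> 1 + e)).
have kA : compact A by apply: compact_joinS; exact: compact_graphS.
have kB : compact B by apply: compact_joinS; exact: compact_graphS.
have cA : convexS A.
  by apply: convexS_joinS; apply: convexS_graphS => //; exact: affine_on_cst.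
have cB : convexS B.
  by apply: convexS_joinS; apply: convexS_graphS => //; exact: affine_on_cst.
have [x0 Fx0] := F0.
have Ax x : F x -> A (x, a x : R^o).
  move=> Fx; exists 1, (x, a x), (x, -1).
  split => //; [by exists x|by exists x; [exact: FK|]|].
  by rewrite subrr scale0r addr0 scale1r.
have Ak k : K k -> A (k, -1 : R^o).
  move=> Kk; exists 0, (x0, a x0), (k, -1); split => //; [by exists x0|by exists k|].
  by rewrite subr0 scale0r add0r scale1r.
have Bx x : F x -> B (x, (a x + e) : R^o).
  move=> Fx; exists 1, (x, a x + e), (x, 1 + e).
  split => //; [by exists x|by exists x; [exact: FK|]|].
  by rewrite subrr scale0r addr0 scale1r.
have Bk k : K k -> B (k, (1 + e) : R^o).
  move=> Kk; exists 0, (x0, a x0 + e), (k, 1 + e); split => //; [by exists x0|by exists k|].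
  by rewrite subr0 scale0r add0r scale1r.
have hW : hausdorff_space (V * R^o)%type.
  by apply: hausdorff_prod => //; exact: Rhausdorff.
have [|l [lD lZ lc l1]] := compact_convex_separation hW (compact_diffS kB kA)
    (convexS_diffS cB cA) _ (split_face_disjoint aF a1 e0).
  exists ((x0, (1 + e) : R^o) - (x0, -1 : R^o)), ((x0, 1 + e), (x0, -1)) => //.
  by split; [exact/Bk/FK|exact/Ak/FK].
have {}l1 p q : A p -> B q -> l p <= l q - 1.
  move=> Ap Bq; have := l1 (q - p); rewrite lD -[- p]scaleN1r lZ.
  have : diffS B A (q + -1 *: p) by exists (q, p); rewrite // scaleN1r.
  by move=> h /(_ h); lra.
pose S := [set l p | p in A].
have lS p : A p -> l p <= sup S.
  move=> Ap; apply: sup_ubound; last by exists p.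
  by exists (l (x0, (1 + e) : R^o) - 1) => _ [q Aq <-]; apply: l1 => //; exact/Bk/FK.
have Sl q : B q -> sup S <= l q - 1.
  move=> Bq; apply: ge_sup; first by exists (l (x0, a x0 : R^o)), (x0, a x0) => //; exact: Ax.
  by move=> _ [p Ap <-]; exact: l1.
pose l2 := l (0, 1 : R^o).
have lE v (r : R) : l (v, r : R^o) = l (v, 0) + r * l2.
  rewrite -lZ -lD; congr l; apply/pair_equal_spec; split => /=.
    by rewrite scaler0 addr0.
  by rewrite /GRing.scale/= mulr1 add0r.
(* The points [(x0, -1)] of [A] and [(x0, 1 + e)] of [B] differ only in height, so separating them
   strictly makes [l] increase vertically. *)
have l2_gt0 : 0 < l2.
  have := l1 _ _ (Ak _ (FK Fx0)) (Bk _ (FK Fx0)); rewrite lE [l (_, 1 + e)]lE => h.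
  have : 0 < (2 + e) * l2 by lra.
  by rewrite pmulr_rgt0//; lra.
pose c v := (sup S - l (v, 0)) / l2.
have cA_le v (r : R) : A (v, r : R^o) -> r <= c v.
  by move=> /lS; rewrite lE /c ler_pdivlMr//; lra.
have cB_ge v (r : R) : B (v, r : R^o) -> c v <= r.
  by move=> /Sl; rewrite lE /c ler_pdivrMr//; lra.
exists c; split.
- split.
    move=> x y t Kx Ky t0 t1; rewrite /c.
    have -> : ((t *: x + (1 - t) *: y), 0 : R^o) = t *: (x, 0 : R^o) + (1 - t) *: (y, 0 : R^o).
      by apply/pair_equal_spec; split; rewrite //= !scaler0 addr0.
    by rewrite lD !lZ; field; rewrite gt_eqF.
  apply: continuous_subspaceT => x; rewrite /c.
  apply: cvgMl; apply: cvgB; first exact: cvg_cst.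
  apply: (@continuous_comp _ _ _ (fun v => (v, 0 : R^o)) l); last exact: lc.
  by apply: (@cvg_pair _ _ _ _ (nbhs (x : V)) (nbhs (0 : R^o))); [exact: cvg_id|exact: cvg_cst].
- move=> k Kk; have := cA_le _ _ (Ak _ Kk); have := cB_ge _ _ (Bk _ Kk).
  by move=> h1 h2; apply/ler_normlP; split; lra.
- move=> x Fx; have := cA_le _ _ (Ax _ Fx); have := cB_ge _ _ (Bx _ Fx).
  by move=> h1 h2; apply/ler_normlP; split; lra.
Qed.

End Extension.

(** The intervals with centre [u n] and radius [r n] are nested; [c] is the infimum of their right
    endpoints. *)
Lemma telescoping_bound_limit (R : realType) (u r : nat -> R) :
  (forall n, `|u n.+1 - u n| <= r n - r n.+1) -> (forall n, 0 <= r n) ->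
  exists c, forall n, `|c - u n| <= r n.
Proof.
move=> ur r0.
have um n j : `|u (n + j)%N - u n| <= r n - r (n + j)%N.
  elim: j => [|j IH]; first by rewrite addn0 !subrr normr0.
  rewrite addnS; have := ler_distD (u (n + j)%N) (u (n + j).+1) (u n).
  by have := ur (n + j)%N; lra.
have uu n m : u n - r n <= u m + r m.
  have [nm|/ltnW mn] := leqP n m.
    have := um n (m - n)%N; rewrite subnKC// ler_distl => /andP[+ _].
    by have := r0 m; lra.
  have := um m (n - m)%N; rewrite subnKC// ler_distl => /andP[_ +].
  by have := r0 n; lra.
exists (inf (range (fun n => u n + r n))) => n.
rewrite ler_distl; apply/andP; split.
  by apply: (@inf_ge _ _ (u 0%N + r 0%N)); [exists 0%N|move=> _ [m _ <-]; exact: uu].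
by apply: (@inf_le_lower _ _ _ (u n - r n)); [move=> _ [m _ <-]; exact: uu|exists n].
Qed.

Lemma small_power (R : realType) (e C h : R) : 0 <= e -> e < 1 -> 0 < h ->
  exists n, C * e ^+ n <= h.
Proof.
move=> e0 e1 h0.
have : (fun n => C * e ^+ n) @ \oo --> C * 0.
  by apply: cvgMr; apply: cvg_expr; rewrite ger0_norm.
rewrite mulr0 => /cvgrPdist_lt/(_ h h0)[n _ /(_ n (leqnn n))] /=.
by rewrite sub0r normrN => hn; exists n; apply: le_trans (ltW hn); exact: ler_norm.
Qed.

(** * The space A(K) and its sup norm *)

Section AffineFunctions.
Variables (R : realType) (V : tvsType R) (K : set V).
Hypothesis kK : compact K.
Implicit Types a b : V -> R.

Lemma AK_cst (r : R) : AK K (fun=> r).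
Proof. by split=> [|x]; [exact: affine_on_cst|exact: cvg_cst]. Qed.

Lemma AKD a b : AK K a -> AK K b -> AK K (fun x => a x + b x).
Proof.
move=> [aK ca] [bK cb]; split; first exact: affine_onD.
by move=> x; apply: cvgD; [exact: ca|exact: cb].
Qed.

Lemma AKZ (r : R) a : AK K a -> AK K (fun x => r * a x).
Proof.
move=> [aK ca]; split; last by move=> x; apply: cvgMr; exact: ca.
by move=> x y t Kx Ky t0 t1; rewrite aK//; ring.
Qed.

Lemma AK_eq a b : convexS K -> (forall k, K k -> a k = b k) -> AK K a -> AK K b.
Proof.
move=> cK ab [aK ca]; split.
  move=> x y t Kx Ky t0 t1.
  by rewrite -(ab _ (cK _ _ _ Kx Ky t0 t1)) -(ab _ Kx) -(ab _ Ky); exact: aK.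
apply/subspace_continuousP => x Kx; rewrite /from_subspace -(ab _ Kx).
move/subspace_continuousP : ca => /(_ x Kx); apply: cvg_trans.
by apply: near_eq_cvg; rewrite near_withinE; apply: nearW => y; exact: ab.
Qed.

Lemma AK_uniform_limit a : convexS K ->
  (forall e, 0 < e -> exists2 b, AK K b & forall k, K k -> `|a k - b k| <= e) ->
  AK K a.
Proof.
move=> cK H; split.
  move=> x y t Kx Ky t0 t1; apply/eqP; rewrite -subr_eq0 -normr_le0.
  apply/ler_addgt0Pl => e e0; rewrite addr0.
  have e2 : 0 < e / 2 by rewrite divr_gt0.
  have [b [bK _] ab] := H _ e2.
  have := ab _ (cK _ _ _ Kx Ky t0 t1); rewrite bK//.
  have := ab _ Kx; have := ab _ Ky.
  move=> /ler_normlP[h1 h2] /ler_normlP[h3 h4] /ler_normlP[h5 h6].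
  have t1' : 0 <= 1 - t by lra.
  have := ler_wpM2l t0 h3; have := ler_wpM2l t0 h4.
  have := ler_wpM2l t1' h1; have := ler_wpM2l t1' h2.
  move=> *; apply/ler_normlP; split; lra.
apply/subspace_continuousP => x Kx; apply/cvgrPdist_lt => e e0.
have e4 : 0 < e / 4 by rewrite divr_gt0.
have [b [_ /subspace_continuousP cb] ab] := H _ e4.
have /cvgrPdist_lt/(_ _ e4) := cb x Kx; rewrite !near_withinE.
apply: filterS => y /[swap] Ky /(_ Ky) h.
have := ler_distD (b x) (a x) (a y); have := ler_distD (b y) (b x) (a y).
have := ab _ Kx; have := ab _ Ky; rewrite [`|a y - _|]distrC; lra.
Qed.

Lemma AK_bounded a : AK K a -> exists M, forall k, K k -> `|a k| <= M.
Proof.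
move=> [_ ca]; have [K0|/nonemptyPn K0] := pselect (K !=set0); last first.
  by exists 0 => k; rewrite K0.
have cna : {within K, continuous (fun x => `|a x|)}.
  by move=> x; apply: cvg_norm; exact: ca.
have [x _ xM] := compact_EVT_max K0 kK cna.
by exists `|a x| => k Kk; apply: xM; exact/mem_set.
Qed.

Lemma supnorm_le a (M : R) : K !=set0 -> (forall k, K k -> `|a k| <= M) ->
  supnorm K a <= M.
Proof.
move=> [k Kk] aM; apply: ge_sup; first by exists `|a k|, k.
by move=> _ [x Kx <-]; exact: aM.
Qed.

Lemma le_supnorm a k : AK K a -> K k -> `|a k| <= supnorm K a.
Proof.
move=> /AK_bounded[M aM] Kk; apply: sup_ubound; last by exists k.
by exists M => _ [x Kx <-]; exact: aM.
Qed.

Lemma supnorm_ge0 a : K !=set0 -> AK K a -> 0 <= supnorm K a.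
Proof. by move=> [k Kk] aK; exact: le_trans (le_supnorm aK Kk). Qed.

End AffineFunctions.

(** * Exact extension from the face and the quotient norm *)

Section ExactExtension.
Variables (R : realType) (V : tvsType R) (K F : set V).
Hypotheses (hV : hausdorff_space V) (kK : compact K) (cK : convexS K).
Hypotheses (clF : closed F) (sF : split_face K F) (F0 : F !=set0).
Implicit Types (a b c g : V -> R).

Let FK : F `<=` K. Proof. by case: sF => -[]. Qed.
Let K0 : K !=set0. Proof. by have [x /FK] := F0; exists x. Qed.

Lemma split_face_approx_scaled a e M : AK K a -> (forall x, F x -> `|a x| <= M) ->
  0 < e -> 0 < M ->
  exists c, [/\ AK K c, forall k, K k -> `|c k| <= M * (1 + e) &
    forall x, F x -> `|a x - c x| <= M * e].
Proof.
move=> aK aM e0 M0.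
have [|c [cAK c1 c2]] := split_face_approx hV kK cK clF sF F0 (AKZ M^-1 aK) _ e0.
  by move=> x Fx; rewrite normrM gtr0_norm ?invr_gt0// ler_pdivrMl// mulr1 aM.
exists (fun x => M * c x); split; first exact: AKZ.
  by move=> k Kk; rewrite normrM gtr0_norm// ler_pM2l// c1.
move=> x Fx; have := c2 x Fx.
rewrite -(ler_pM2l M0) -{1}[M]gtr0_norm// -normrM mulrBr mulrA divff ?gt_eqF//.
by rewrite mul1r.
Qed.

(* Correcting the error on [F] repeatedly gives a geometric series; the ratio
   [d / (2 + d)] makes its sum [M * (1 + d)]. *)
Lemma split_face_extension a M d : AK K a -> (forall x, F x -> `|a x| <= M) ->
  0 < M -> 0 < d ->
  exists c, [/\ AK K c, forall k, K k -> `|c k| <= M * (1 + d) &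
    forall x, F x -> c x = a x].
Proof.
move=> aK aM M0 d0; pose e := d / (2 + d).
have e0 : 0 < e by rewrite divr_gt0//; lra.
have e1 : e < 1 by rewrite ltr_pdivrMr; lra.
have eE : M * (1 + d) * (1 - e) = M * (1 + e).
  by rewrite /e; field; lra.
pose P n b := AK K b /\ forall x, F x -> `|a x - b x| <= M * e ^+ n.
(* The correction step is made total: where [P] fails, [b] itself is a dummy value. *)
have /choice[step stepP] : forall nb : nat * (V -> R), exists c, P nb.1 nb.2 ->
    P nb.1.+1 c /\ forall k, K k -> `|c k - nb.2 k| <= M * e ^+ nb.1 * (1 + e).
  move=> [n b] /=; have [[bK ab]|nP] := pselect (P n b); last by exists b.
  have abK := AKD aK (AKZ (-1) bK).
  have [||c [cAK c1 c2]] := @split_face_approx_scaled _ e (M * e ^+ n) abK _ e0.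
    by move=> x Fx; rewrite mulN1r; exact: ab.
    by rewrite mulr_gt0// exprn_gt0.
  exists (fun x => b x + c x) => _; split; last by move=> k /c1; rewrite /= addrAC subrr add0r.
  split; first exact: AKD.
  move=> x /c2; rewrite mulN1r exprSr mulrA; congr (`|_| <= _); ring.
pose b := fix b n := if n is m.+1 then step (m, b m) else (fun=> 0).
have bP n : P n (b n).
  elim: n => [|n IH]; last by have [] := stepP (n, b n) IH.
  by split=> [|x Fx]; [exact: AK_cst|rewrite subr0 expr0 mulr1; exact: aM].
have bS n k : K k -> `|b n.+1 k - b n k| <= M * e ^+ n * (1 + e).
  by move=> Kk; have [_ /(_ k Kk)] := stepP (n, b n) (bP n).
(* The tail of the geometric series bounding the corrections from stage [n] on. *)
pose r n := M * (1 + d) * e ^+ n.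
have rS n : r n - r n.+1 = M * e ^+ n * (1 + e).
  by rewrite mulrAC -eE /r exprSr; ring.
have r0 n : 0 <= r n by rewrite /r !mulr_ge0 ?exprn_ge0//; lra.
have /choice[c cP] : forall k, exists ck, K k -> forall n, `|ck - b n k| <= r n.
  move=> k; have [Kk|nK] := pselect (K k); last by exists 0.
  have [|ck h] := @telescoping_bound_limit _ (fun n => b n k) r _ r0.
    by move=> n; rewrite rS; exact: bS.
  by exists ck.
exists c; split.
- apply: AK_uniform_limit => // h h0.
  have [n nh] := small_power (M * (1 + d)) (ltW e0) e1 h0.
  exists (b n); first by have [] := bP n.
  by move=> k Kk; exact: le_trans (cP k Kk n) nh.
- by move=> k Kk; have := cP k Kk 0%N; rewrite /r expr0 mulr1 subr0.
- move=> x Fx; apply/eqP; rewrite -subr_eq0 -normr_le0.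
  apply/ler_addgt0Pl => h h0; rewrite addr0.
  (* The two summands bound the distances of [b n x] from [c x] and from [a x]. *)
  have [n nh] := small_power (M * (1 + d) + M) (ltW e0) e1 h0.
  have := cP x (FK Fx) n; have := (bP n).2 x Fx.
  have := ler_distD (b n x) (c x) (a x); rewrite /r [`|a x - _|]distrC; lra.
Qed.

Lemma qnorm_lbound g : lbound
  [set supnorm K a | a in [set a | AK K a /\ forall k, F k -> a k = g k]] 0.
Proof. by move=> _ [a [aK _] <-]; exact: supnorm_ge0. Qed.

Lemma qnorm_le_supnorm a g : AK K a -> (forall k, F k -> a k = g k) ->
  qnorm K F g <= supnorm K a.
Proof. by move=> aK ag; apply: (inf_le_lower (@qnorm_lbound g)); exists a. Qed.

(** Extending with relative error [h / M] gives a representative of sup norm at most [M + h], for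
    every [h > 0]. *)
Lemma qnorm_le g M : quot_elem K F g -> 0 < M -> (forall x, F x -> `|g x| <= M) ->
  qnorm K F g <= M.
Proof.
move=> [a [aK ag]] M0 gM; apply/ler_addgt0Pl => h h0.
have [|c [cAK cM ca]] := split_face_extension aK _ M0 (divr_gt0 h0 M0).
  by move=> x Fx; rewrite ag// gM.
apply: le_trans (qnorm_le_supnorm cAK _) _; first by move=> k Fk; rewrite ca// ag.
apply: supnorm_le => // k /cM; congr (_ <= _); field; exact: lt0r_neq0.
Qed.

(** Every extension of [g] already takes on [F] all the values of [b], so [b] has the least sup norm
    among them. *)
Lemma supnorm_eq_qnorm b g : AK K b -> (forall k, F k -> b k = g k) ->
  (forall k, K k -> exists2 x, F x & b k = g x) -> supnorm K b = qnorm K F g.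
Proof.
move=> bK bg H; apply/le_anti/andP; split; last exact: qnorm_le_supnorm.
apply: (@inf_ge _ _ (supnorm K b)); first by exists b.
move=> _ [a [aK ag] <-]; apply: supnorm_le => // k /H[x Fx ->].
by rewrite -ag//; apply: le_supnorm => //; exact: FK.
Qed.

End ExactExtension.

(** * States of spaces of affine functions *)

Section States.
Variables (R : realType) (V : tvsType R) (F : set V).
Hypotheses (kF : compact F) (cF : convexS F) (F0 : F !=set0).
Variables (E : lmodType R) (ev : E -> V -> R) (u : E).
Hypotheses (evA : forall x, AK F (ev x)) (evL : lin_on F ev).
Hypothesis evu : forall k, F k -> ev u k = 1.
Variable p : E -> R.
Hypothesis pL : forall c x y, p (c *: x + y) = c * p x + p y.
Hypothesis pu : p u = 1.
Hypothesis p_ge0 : forall x, (forall k, F k -> 0 <= ev x k) -> 0 <= p x.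

Let p0 : p 0 = 0.
Proof. by have := pL (-1) 0 0; rewrite scaler0 addr0; lra. Qed.

Let ev0 k : F k -> ev 0 k = 0.
Proof. by move=> Fk; have := evL (-1) 0 0 Fk; rewrite scaler0 addr0; lra. Qed.

Let p_sum (s : seq E) (d : E -> R) :
  p (\sum_(x <- s) d x *: x) = \sum_(x <- s) d x * p x.
Proof.
by elim: s => [|x s IH]; rewrite ?big_nil// !big_cons pL IH.
Qed.

Let ev_sum (s : seq E) (d : E -> R) k : F k ->
  ev (\sum_(x <- s) d x *: x) k = \sum_(x <- s) d x * ev x k.
Proof.
move=> Fk; elim: s => [|x s IH]; first by rewrite !big_nil ev0.
by rewrite !big_cons evL// IH.
Qed.

(* Minimise the sum of the squares of [ev x - p x] over [F]: the first order
   condition contradicts the positivity of [p] unless the minimum is [0]. *)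
Lemma state_finite (s : seq E) : exists2 y, F y & forall x, x \in s -> ev x y = p x.
Proof.
pose g y := \sum_(x <- s) (ev x y - p x) ^+ 2.
have cg : {within F, continuous g}.
  rewrite /g; elim: (s) => [|x s' IH].
    by under eq_fun do rewrite big_nil; move=> ?; exact: cvg_cst.
  under eq_fun do rewrite big_cons.
  move=> y; apply: cvgD; last exact: IH.
  have [_ cx] := evA x.
  under eq_fun do rewrite expr2.
  by apply: cvgM; apply: cvgB; [exact: cx|exact: cvg_cst|exact: cx|exact: cvg_cst].
have [y0 /set_mem Fy0 gmin] := compact_EVT_min F0 kF cg.
pose d x := ev x y0 - p x.
have first_order y : F y -> 0 <= \sum_(x <- s) d x * (ev x y - ev x y0).
  move=> Fy; set S := \sum_(x <- s) _.
  pose Q := \sum_(x <- s) (ev x y - ev x y0) ^+ 2.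
  have Q0 : 0 <= Q by apply: sumr_ge0 => x _; exact: sqr_ge0.
  (* Minimality of [g] at [y0] along the segment towards [y], divided by [t]. *)
  have St t : 0 < t -> t <= 1 -> 0 <= 2 * S + t * Q.
    move=> t0 t1; have Fz := cF Fy Fy0 (ltW t0) t1.
    have := gmin _ (mem_set Fz).
    have -> : g (t *: y + (1 - t) *: y0) = g y0 + t * (2 * S + t * Q).
      rewrite /g /S /Q mulrDr !mulr_sumr -!big_split /=; apply: eq_bigr => x _.
      by rewrite (evA x).1 ?(ltW t0)// /d; ring.
    by rewrite lerDl pmulr_rge0.
  rewrite leNgt; apply/negP => S0.
  have QS : 0 < Q - S by lra.
  (* If [S < 0], this [t] lies in [(0, 1]] and makes [2 * S + t * Q] equal to
     [S * (Q - 2 * S) / (Q - S)], which is negative. *)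
  have := St (- S / (Q - S)); rewrite divr_gt0 ?oppr_gt0// => /(_ isT).
  rewrite ler_pdivrMr// mul1r; have -> : - S <= Q - S by lra.
  move=> /(_ isT); have -> : 2 * S + - S / (Q - S) * Q = (S * Q - 2 * S * S) / (Q - S).
    by field; lra.
  rewrite pmulr_lge0 ?invr_gt0//; nra.
(* By [first_order], [b] minus its value at [y0] is non-negative on [F]. Applying [p] shows that
   minus the sum of the squares of [d x] is non-negative. *)
pose b := \sum_(x <- s) d x *: x.
have : 0 <= p (- (ev b y0) *: u + b).
  apply: p_ge0 => k Fk; rewrite evL// evu// mulr1 !ev_sum//.
  have := first_order k Fk; under eq_bigr do rewrite mulrBr.
  by rewrite sumrB; lra.
rewrite pL pu mulr1 p_sum ev_sum// => h.
have : \sum_(x <- s) d x ^+ 2 == 0.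
  rewrite eq_le sumr_ge0 ?andbT => [|x _]; last exact: sqr_ge0.
  under eq_bigr do rewrite expr2 {2}/d mulrBr.
  by rewrite sumrB; lra.
rewrite psumr_eq0 => [/allP ds|x _]; last exact: sqr_ge0.
exists y0 => // x /ds /=; rewrite sqrf_eq0 subr_eq0; exact/eqP.
Qed.

(** By [state_finite] the sets [Z s] are nonempty, so they generate a proper filter on the compact
    set [F]. Continuity of each [ev x] gives [ev x y = p x] at a cluster point [y]. *)
Lemma state_evaluation : exists2 y, F y & forall x, ev x y = p x.
Proof.
pose Z (s : seq E) := [set y | F y /\ forall x, x \in s -> ev x y = p x].
have fZ : ProperFilter (filter_from setT Z).
  apply: filter_from_proper; last first.
    by move=> s _; have [y Fy ys] := state_finite s; exists y.
  apply: filter_from_filter; first by exists [::].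
  move=> s t _ _; exists (s ++ t) => // y [Fy yst]; split; split => // x xs.
    by apply: yst; rewrite mem_cat xs.
  by apply: yst; rewrite mem_cat xs orbT.
have ZF : filter_from setT Z F by exists [::] => // y [].
have [y [Fy cly]] := kF fZ ZF.
exists y => // x; apply/eqP; apply: contrapT => /negP nxy.
have d0 : 0 < `|ev x y - p x| by rewrite normr_gt0 subr_eq0.
have [_ /subspace_continuousP/(_ y Fy)/cvgrPdist_lt/(_ _ d0)] := evA x.
rewrite near_withinE => /(cly (Z [:: x])) []; first by exists [:: x].
move=> z [[Fz zx] /(_ Fz)]; rewrite /from_subspace zx ?mem_seq1// ltxx.
by [].
Qed.

End States.

(** * The quotient A(K)/J as a vector space *)

Section QuotientSpace.
Variables (R : realType) (V : tvsType R) (K F : set V).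

(* Elements of [A(K)/J], normalised to vanish off [F] so that equality of
   functions is equality of classes. *)
Definition quot_pred : {pred V -> R^o} :=
  fun f => `[< quot_elem K F f /\ forall k, ~ F k -> f k = 0 >].

Lemma quot_pred_submod : submod_closed quot_pred.
Proof.
split.
  apply/asboolP; split=> //; exists (fun=> 0); split=> //; exact: AK_cst.
move=> c f g /asboolP[[a [aK af]] f0] /asboolP[[b [bK bg]] g0]; apply/asboolP.
split.
  exists (fun k => c * a k + b k); split; first exact: AKD (AKZ c aK) bK.
  by move=> k Fk; rewrite af// bg.
by move=> k nFk; rewrite -[LHS]/(c * f k + g k) f0// g0// mulr0 addr0.
Qed.

HB.instance Definition _ := GRing.isSubmodClosed.Build R (V -> R^o) quot_pred quot_pred_submod.

Record AKquot := QuotType { quot_fun : V -> R^o; quot_funP : quot_fun \in quot_pred }.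

HB.instance Definition _ := [isSub for quot_fun].
HB.instance Definition _ := [Choice of AKquot by <:].
HB.instance Definition _ := [SubChoice_isSubLmodule of AKquot by <:].

End QuotientSpace.

(** * The retraction *)

Section AffineSeparation.
Variables (R : realType) (V : tvsType R) (K : set V).
Hypothesis hV : hausdorff_space V.

(** If [x] and [y] differ, the compact convex set consisting of [x - y] is separated from 0 by a
    continuous linear functional. *)
Lemma AK_separates (x y : V) : (forall a, AK K a -> a x = a y) -> x = y.
Proof.
move=> H; apply: contrapT => xy.
have [|||l [lD lZ lc l1]] := compact_convex_separation hV (@compact_set1 _ (x - y)).
- move=> _ _ t /= -> -> _ _; rewrite -scalerDl addrC subrK scale1r //.
- by exists (x - y).
- by move=> /= /esym/eqP; rewrite subr_eq0 => /eqP.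
have := l1 _ erefl; rewrite lD -scaleN1r lZ (H l); first by rewrite mulN1r subrr; lra.
split; last exact: continuous_subspaceT.
by move=> a b t _ _ _ _; rewrite lD !lZ.
Qed.

(** If [phi] were discontinuous at [k], its values near [k] outside some neighbourhood of [phi k]
    would cluster at a point [y] of the compact set [F]. Continuity of every [a \o phi] gives
    [a y = a (phi k)], so [y = phi k], a contradiction. *)
Lemma AK_comp_continuous (F : set V) (phi : V -> V) : F `<=` K -> compact F ->
  convexS F -> (forall k, K k -> F (phi k)) ->
  (forall a, AK K a -> AK K (a \o phi)) -> {within K, continuous phi}.
Proof.
move=> FK kF cF phiF aphi; apply/subspace_continuousP => k Kk.
rewrite /from_subspace.
pose G := phi @ within K (nbhs k).
have GG : Filter G by exact: fmap_filter.
move=> U Uphi; apply: contrapT => nGU.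
pose G' := within (~` U) G.
have pG' : ProperFilter G'.
  split; last exact: within_filter.
  move=> GF; apply: nGU; apply: (@filterS _ G GG _ _ _ GF) => z /= h; exact: contrapT.
have GG' A : G A -> G' A by apply: (@filterS _ G GG) => z Az _.
have G'F : G' F.
  apply: GG'; change (\forall z \near k, K z -> F (phi z)).
  by apply: nearW => z; exact: phiF.
have [y [Fy cly]] := kF G' pG' G'F.
suff yE : y = phi k.
  rewrite yE in cly.
  by have [z []] := cly (~` U) U (withinT _ _) Uphi.
apply: AK_separates => a aK; apply: contrapT => /eqP ne.
have d0 : 0 < `|a y - a (phi k)| / 2.
  by rewrite divr_gt0// normr_gt0 subr_eq0.
have [_ /subspace_continuousP/(_ y (FK _ Fy))/cvgrPdist_lt/(_ _ d0) c1] := aK.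
have [_ /subspace_continuousP/(_ k Kk)/cvgrPdist_lt/(_ _ d0) c2] := aphi _ aK.
rewrite !near_withinE in c1 c2.
have G2 : G' [set z | F z /\ `|a (phi k) - a z| < `|a y - a (phi k)| / 2].
  apply: GG'; change (\forall z \near k, K z ->
    F (phi z) /\ `|a (phi k) - a (phi z)| < `|a y - a (phi k)| / 2).
  by apply: filterS c2 => z h Kz; split; [exact: phiF|exact: h].
have [z [[Fz h1] h2]] := cly _ _ G2 c1.
have := h2 (FK _ Fz); rewrite /from_subspace => h3.
have := ler_distD (a z) (a y) (a (phi k)); rewrite [`|a z - _|]distrC; lra.
Qed.

End AffineSeparation.

(** * The order unit space A(K)/J and the retraction obtained from a lift of its identity *)

Section QuotientOUS.
Variables (R : realType) (V : tvsType R) (K F : set V).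
Hypotheses (hV : hausdorff_space V) (kK : compact K) (cK : convexS K).
Hypotheses (clF : closed F) (sF : split_face K F) (F0 : F !=set0).
Local Notation E := (AKquot K F).
Implicit Types f g : E.

Let FK : F `<=` K. Proof. by case: sF => -[]. Qed.
Let cF : convexS F. Proof. by case: sF => -[_ []]. Qed.

Lemma quot_fun_lin (c : R) f g k :
  quot_fun (c *: f + g) k = c * quot_fun f k + quot_fun g k.
Proof. by []. Qed.

Lemma quot_funD f g k : quot_fun (f + g) k = quot_fun f k + quot_fun g k.
Proof. by []. Qed.

Lemma quot_funZ (c : R) f k : quot_fun (c *: f) k = c * quot_fun f k.
Proof. by []. Qed.

Lemma quot_funN f k : quot_fun (- f) k = - quot_fun f k.
Proof. by []. Qed.

Lemma quot_fun0 k : quot_fun (0 : E) k = 0.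
Proof. by []. Qed.

Lemma quot_fun_elem f : quot_elem K F (quot_fun f).
Proof. by have /asboolP[] := quot_funP f. Qed.

Lemma quot_class_subproof (a : V -> R) : AK K a ->
  (fun k => if `[< F k >] then a k else 0 : R^o) \in quot_pred K F.
Proof.
move=> aK; apply/asboolP; split; last by move=> k nFk; case: asboolP.
by exists a; split => // k Fk; case: asboolP.
Qed.

Definition quot_class (a : V -> R) (aK : AK K a) : E :=
  QuotType (quot_class_subproof aK).

Lemma quot_classE a (aK : AK K a) k : F k -> quot_fun (quot_class aK) k = a k.
Proof. by rewrite /=; case: asboolP. Qed.

Definition quot_unit : E := quot_class (AK_cst K 1).

Lemma quot_unitE k : F k -> quot_fun quot_unit k = 1.
Proof. by move=> Fk; rewrite quot_classE. Qed.

Definition quot_le f g := forall k, F k -> quot_fun f k <= quot_fun g k.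

Lemma quot_fun_AK f : AK F (quot_fun f).
Proof.
have [a [[aK ca] af]] := quot_fun_elem f.
apply: (AK_eq cF af); split; first exact: affine_on_sub aK.
exact: continuous_subspaceW ca.
Qed.

Lemma quot_fun_bounded f :
  exists2 M, 0 < M & forall k, F k -> `|quot_fun f k| <= M.
Proof.
have [a [aK af]] := quot_fun_elem f; have [M aM] := AK_bounded kK aK.
exists (`|M| + 1); first by rewrite ltr_wpDl.
move=> k Fk; rewrite -af//; have := aM _ (FK Fk); have := ler_norm M; lra.
Qed.

(** This identifies the order unit norm of A(K)/J with the sup norm over [F]. *)
Lemma quot_le_unitP f (l : R) :
  (forall k, F k -> `|quot_fun f k| <= l) <->
  (quot_le (- (l *: quot_unit)) f /\ quot_le f (l *: quot_unit)).
Proof.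
split=> [fl|[h1 h2] k Fk].
  split=> k Fk; have := fl _ Fk; rewrite ler_norml => /andP[h1 h2];
    by rewrite ?quot_funN quot_funZ quot_unitE// mulr1.
have := h1 _ Fk; have := h2 _ Fk.
rewrite quot_funN !quot_funZ quot_unitE// mulr1 => ? ?.
by rewrite ler_norml; apply/andP.
Qed.

Lemma quot_OUS : is_OUS quot_le quot_unit.
Proof.
split.
- by move=> f k _.
- move=> f g fg gf; apply: val_inj; apply/funext => k /=.
  have [Fk|nFk] := pselect (F k).
    by apply/le_anti/andP; split; [exact: fg|exact: gf].
  (* Off [F] both representatives vanish by normalisation. *)
  have /asboolP[_ ->//] := quot_funP f; by have /asboolP[_ ->] := quot_funP g.
- by move=> f g h fg gh k Fk; exact: le_trans (fg k Fk) (gh k Fk).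
- by move=> f g h fg k Fk; rewrite !quot_funD lerD2r; exact: fg.
- by move=> c f g c0 fg k Fk; rewrite !quot_funZ ler_wpM2l//; exact: fg.
- by move=> f; have [M _ fM] := quot_fun_bounded f; exists M; exact/quot_le_unitP.
- move=> f H k Fk; rewrite quot_fun0; apply/ler_addgt0Pl => e e0; rewrite addr0.
  by have := H e e0 k Fk; rewrite quot_funZ quot_unitE// mulr1.
Qed.

Local Notation nE := (ounorm quot_le quot_unit).

Lemma quot_ounorm_ge (c : R) f :
  (forall l, 0 < l -> (forall k, F k -> `|quot_fun f k| <= l) -> c <= l) -> c <= nE f.
Proof.
move=> H; have [M M0 fM] := quot_fun_bounded f.
apply: (@inf_ge _ _ M); first by split => //; exact/quot_le_unitP.
by move=> l [l0 /quot_le_unitP]; exact: H.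
Qed.

Lemma quot_ounorm_unit_le1 : nE quot_unit <= 1.
Proof.
apply: (@inf_le_lower _ _ _ 0); first by move=> l [/ltW].
split => //; apply/quot_le_unitP => k Fk.
by rewrite quot_unitE// normr1.
Qed.

Lemma qnorm_le_ounorm f : qnorm K F (quot_fun f) <= nE f.
Proof.
by apply: quot_ounorm_ge => l l0 fl; apply: qnorm_le => //; exact: quot_fun_elem.
Qed.

(* The lift need not map the unit to [1] off [F]; adding the multiple
   [1 - T' 1] of a fixed point evaluation normalises it, turning each
   [k] into a state of [A(K)/J], hence into a point of [F]. *)
Lemma affine_retraction (T' : E -> V -> R) :
  (forall f, AK K (T' f)) -> lin_on K T' ->
  (forall f, quot_le 0 f -> forall k, K k -> 0 <= T' f k) ->
  (forall f k, F k -> T' f k = quot_fun f k) ->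
  (forall k, K k -> T' quot_unit k <= 1) ->
  exists phi : V -> V, [/\ forall k, K k -> F (phi k), affine_map_on K phi,
    {within K, continuous phi}, forall k, F k -> phi k = k &
    forall a, AK K a -> AK K (a \o phi)].
Proof.
move=> T'K T'L T'0 T'F T'1; have [x0 Fx0] := F0.
have kF : compact F by exact: subclosed_compact kK FK.
pose p k f := T' f k + (1 - T' quot_unit k) * quot_fun f x0.
have /choice[phi phiP] : forall k, exists y, K k ->
    F y /\ forall f, quot_fun f y = p k f.
  move=> k; have [Kk|nK] := pselect (K k); last by exists k.
  have [|||y Fy yp] := @state_evaluation _ _ _ kF cF F0 _ _ quot_unit
    quot_fun_AK (fun c f g k _ => quot_fun_lin c f g k) quot_unitE (p k).
  - by move=> c f g; rewrite /p T'L// quot_fun_lin; ring.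
  - by rewrite /p quot_unitE//; ring.
  - move=> f f0; apply: addr_ge0; first exact: T'0.
    by apply: mulr_ge0; [rewrite subr_ge0 T'1|exact: f0].
  - by exists y.
have phiF k : K k -> F (phi k) by move=> /phiP[].
have aphiE a (aK : AK K a) k : K k -> a (phi k) = p k (quot_class aK).
  by move=> Kk; rewrite -(quot_classE aK (phiF k Kk)); have [_ ->] := phiP _ Kk.
have aphi a : AK K a -> AK K (a \o phi).
  move=> aK; apply: (@AK_eq _ _ _ (fun k => p k (quot_class aK))) => //.
    by move=> k Kk /=; rewrite (aphiE _ aK).
  apply: AKD => //.
  apply: (@AK_eq _ _ _ (fun k => quot_fun (quot_class aK) x0 * (1 + -1 * T' quot_unit k))) => //.
    by move=> k _; ring.
  by apply: AKZ; apply: AKD; [exact: AK_cst|exact: AKZ].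
exists phi; split => //.
(* Identities between points are tested on A(K), which separates them. *)
- move=> x y t Kx Ky t0 t1; apply: (@AK_separates _ _ K hV) => a aK.
  have [h _] := aphi _ aK; rewrite -[LHS]/((a \o phi) _) h//=.
  by rewrite aK.1//; exact/FK/phiF.
- exact: (AK_comp_continuous hV FK kF cF).
(* On [F] the lift sends the unit to 1, so the correction term of [p] vanishes. *)
- move=> k Fk; apply: (@AK_separates _ _ K hV) => a aK.
  rewrite (aphiE _ aK _ (FK Fk)) /p !T'F// quot_unitE// subrr mul0r addr0.
  by rewrite quot_classE.
Qed.

(** The unit has norm at most 1, and the lift has the norm of the identity, which is at most 1 by
    [qnorm_le_ounorm]. Boundedness of [T'] ensures that the [sup] in [opnorm] is an upper bound. *)
Lemma lift_unit_le1 (T' : E -> V -> R) : (forall f, AK K (T' f)) ->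
  bounded_op nE (supnorm K) T' ->
  opnorm nE (supnorm K) T' = opnorm nE (qnorm K F) (fun f => quot_fun f) ->
  forall k, K k -> T' quot_unit k <= 1.
Proof.
move=> T'K [M T'M] T'n k Kk.
apply: le_trans (ler_norm _) _; apply: le_trans (le_supnorm kK (T'K _) Kk) _.
apply: (@le_trans _ _ (opnorm nE (supnorm K) T')).
  apply: sup_ubound; last by exists quot_unit => //; exact: quot_ounorm_unit_le1.
  exists `|M| => _ [f /= f1 <-]; apply: le_trans (T'M f) _.
  have f0 : 0 <= nE f by apply: quot_ounorm_ge => l /ltW.
  apply: (@le_trans _ _ (`|M| * nE f)); first by rewrite ler_wpM2r// ler_norm.
  by rewrite -[leRHS]mulr1 ler_wpM2l.
rewrite T'n; apply: ge_sup.
  by exists (qnorm K F (quot_fun quot_unit)), quot_unit => //; exact: quot_ounorm_unit_le1.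
by move=> _ [f /= f1 <-]; exact: le_trans (qnorm_le_ounorm f) f1.
Qed.

End QuotientOUS.

(** * The retraction and the quotient lifting property *)

Theorem theorem6 (R : realType) (V : tvsType R) (K F : set V) :
  hausdorff_space V ->
  compact K -> convexS K ->
  closed F -> split_face K F -> F !=set0 ->
  (* lifting of non-negative operators from order unit spaces *)
  (forall (E : lmodType R) (le : E -> E -> Prop) (u : E), is_OUS le u ->
   forall T : E -> V -> R,
     (forall x, quot_elem K F (T x)) -> lin_on F T ->
     bounded_op (ounorm le u) (qnorm K F) T ->
     (forall x, le 0 x -> forall k, F k -> 0 <= T x k) ->
     exists T' : E -> V -> R,
       [/\ (forall x, AK K (T' x)) /\ lin_on K T',
           bounded_op (ounorm le u) (supnorm K) T',
           (forall x, le 0 x -> forall k, K k -> 0 <= T' x k),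
           (forall x k, F k -> T' x k = T x k) &
           opnorm (ounorm le u) (supnorm K) T'
             = opnorm (ounorm le u) (qnorm K F) T]) ->
  (exists phi : V -> V,
     [/\ (forall k, K k -> F (phi k)), affine_map_on K phi,
         {within K, continuous phi} & (forall k, F k -> phi k = k)])
  /\
  (* quotient lifting property of (A(K), J) *)
  (forall (Y : completeNormedModType R) (S : Y -> V -> R),
     (forall y, quot_elem K F (S y)) -> lin_on F S ->
     bounded_op (fun y : Y => `|y|) (qnorm K F) S ->
     exists T : Y -> V -> R,
       [/\ (forall y, AK K (T y)), lin_on K T,
           bounded_op (fun y : Y => `|y|) (supnorm K) T,
           (forall y k, F k -> T y k = S y k) &
           opnorm (fun y : Y => `|y|) (supnorm K) T
             = opnorm (fun y : Y => `|y|) (qnorm K F) S]).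
Proof.
move=> hV kK cK clF sF F0 lift.
have FK : F `<=` K by case: sF => -[].
(* The hypothesis is applied to the order unit space A(K)/J itself and its identity map. *)
have [||||T' [[T'K T'L] T'b T'0 T'F T'n]] :=
  lift _ _ _ (quot_OUS kK sF) (fun f => quot_fun f).
- exact: quot_fun_elem.
- by move=> c f g k _; exact: quot_fun_lin.
- by exists 1 => f; rewrite mul1r; exact: qnorm_le_ounorm.
- by move=> f f0 k /f0.
have T'1 := lift_unit_le1 hV kK cK clF sF F0 T'K T'b T'n.
have [phi [phiF phiA phiC phiK aphi]] :=
  affine_retraction hV kK cK clF sF F0 T'K T'L T'0 T'F T'1.
split; first by exists phi.
move=> Y S Sq SL [M SM].
(* On [F], [S y] agrees with some [a] in A(K), and [phi] takes values in [F]. *)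
have SphiK y : AK K (S y \o phi).
  have [a [aK aS]] := Sq y.
  by apply: AK_eq cK _ (aphi _ aK) => k Kk /=; exact/aS/phiF.
have Sn y : supnorm K (S y \o phi) = qnorm K F (S y).
  apply: supnorm_eq_qnorm => //.
    by move=> k Fk /=; rewrite phiK.
  by move=> k Kk; exists (phi k); first exact: phiF.
exists (fun y => S y \o phi); split => //.
- by move=> c x y k Kk /=; rewrite SL//; exact: phiF.
- by exists M => y; rewrite Sn.
- by move=> y k Fk /=; rewrite phiK.
- by rewrite /opnorm; congr sup; apply: eq_imagel => y _; exact: Sn.
Qed.
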